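(* There exists a function $\tau:\mathbb{Z}_{\ge 1}\to[1,\infty)$ such that the following holds for all $m,n \in \mathbb{Z}_{\ge 1}$ and every $A\in\mathbb{Z}^{m\times n}$ with $\operatorname{rank}(A)=n$: if $m\le n+\sqrt{n/\tau(\Delta(A))}$, then for all $b\in\mathbb{Z}^m$ the feasibility of $P(A,b)\cap\mathbb{Z}^n$ can be tested using a $W\text{-}\mathrm{MIP}$ relaxation with fewer than $n$ integrality constraints; that is, there exist an integer $0\le k<n$ and a matrix $W\in\mathbb{Z}^{k\times n}$ such that $W\text{-}\mathrm{MIP}(A,b)\ne\emptyset$ if and only if $P(A,b)\cap\mathbb{Z}^n\neq\emptyset$.
   Context: For $A\in\mathbb{Z}^{m\times n}$ and $b\in\mathbb{Z}^m$, let $P(A,b):=\{x\in\mathbb{R}^n : Ax\le b\}$. For $W\in\mathbb{Z}^{k\times n}$ let $W\text{-}\mathrm{MIP}(A,b):=\operatorname{conv}\{x\in P(A,b): Wx\in\mathbb{Z}^k\}$ (for $k=0$ this equals $P(A,b)$); it is a relaxation with $k$ integrality constraints. For a real matrix $C$, $\Delta(C):=\max\{|\det(B)| : B \text{ is a } \operatorname{rank}(C)\times\operatorname{rank}(C)\text{ submatrix of } C\}$. *)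

(* Defs.v *)
From HB Require Import structures.
From mathcomp Require Import all_boot all_order all_algebra.
From mathcomp Require Import boolp classical_sets reals convex.

Set Implicit Arguments.
Unset Strict Implicit.
Unset Printing Implicit Defensive.

Import Order.TTheory GRing.Theory Num.Theory.

Local Open Scope classical_set_scope.
Local Open Scope ring_scope.

Definition intr_mx (R : realType) (m n : nat) (A : 'M[int]_(m, n)) :
    'M[R]_(m, n) := map_mx intr A.

Definition increasing_sel (r m : nat) (f : {ffun 'I_r -> 'I_m}) : bool :=
  [forall i : 'I_r, forall j : 'I_r, (i < j)%N ==> (f i < f j)%N].

(* The r x r submatrices of C are the [mxsub f g C] with f and g strictly
   increasing. The index set is nonempty when r = \rank C and the terms are
   nonnegative, so the default value 0 plays no role. *)
Definition Delta (R : realType) (m n : nat) (C : 'M[R]_(m, n)) : R :=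
  \big[Num.max/0]_(fg : {ffun 'I_(\rank C) -> 'I_m} *
                        {ffun 'I_(\rank C) -> 'I_n}
                   | increasing_sel fg.1 && increasing_sel fg.2)
     `|\det (mxsub fg.1 fg.2 C)|.

Definition Delta_int (R : realType) (m n : nat) (A : 'M[int]_(m, n)) : nat :=
  Num.truncn (Delta (intr_mx R A)).

(* No information is lost by the truncation in [Delta_int]. *)
Lemma Delta_intE (R : realType) (m n : nat) (A : 'M[int]_(m, n)) :
  (Delta_int R A)%:R = Delta (intr_mx R A).
Proof.
apply: truncnK; rewrite /Delta.
elim/big_ind: _ => [|x y xn yn|[f g] _].
- exact: rpred0.
- by rewrite /Num.max; case: ifP.
- rewrite /intr_mx -map_mxsub det_map_mx /=.
  by apply: natr_norm_int; apply: intr_int.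
Qed.

Definition polyhedron (R : realType) (m n : nat)
    (A : 'M[int]_(m, n)) (b : 'cV[int]_m) : set 'cV[R]_n :=
  [set x | forall i, (intr_mx R A *m x) i 0 <= intr_mx R b i 0].
Arguments polyhedron R {m n} A b.

Definition integral_vectors (R : realType) (n : nat) : set 'cV[R]_n :=
  [set x | forall i, x i 0 \is a Num.int].
Arguments integral_vectors : clear implicits.

Definition convex_hull (R : realType) (n : nat) (S : set 'cV[R]_n) :
    set 'cV[R]_n :=
  smallest (@convex_set R 'cV[R]_n) S.

Definition W_MIP (R : realType) (m n k : nat) (W : 'M[int]_(k, n))
    (A : 'M[int]_(m, n)) (b : 'cV[int]_m) : set 'cV[R]_n :=
  convex_hull [set x | polyhedron R A b x /\
                       integral_vectors R k (intr_mx R W *m x)].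
Arguments W_MIP R {m n k} W A b.

(* Main.v *)
Require Import Defs.
From HB Require Import structures.
From mathcomp Require Import all_boot all_order all_algebra.
From mathcomp Require Import boolp classical_sets reals convex.
From mathcomp Require Import perm lra ring zify.

Set Implicit Arguments.
Unset Strict Implicit.
Unset Printing Implicit Defensive.

Import Order.TTheory GRing.Theory Num.Theory.

Local Open Scope classical_set_scope.
Local Open Scope ring_scope.

(** The whole question reduces to finding one nonzero integral vector [v] with
    [A v] in {-1, 0, 1}^m.  Given such a [v], complete it to [n - 1] integral
    rows [W] whose integrality puts [x] on a line [w + s v] through an integral
    point [w] ([exists_line_relaxation]).  Along that line each constraint of
    [P(A, b)] either ignores [s] or bounds it by an integer, because [A w], [b]
    and the slopes [A v] are integral and the slopes are at most 1 in absolute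
    value; so [s] may be rounded up and [P(A, b)] contains an integral point
    as soon as the relaxation is nonempty ([flat_direction_rounding]).

    Such a [v] comes from the pigeonhole principle.  Let [B] be a nonsingular
    [n x n] row submatrix of [A] and put [D = Delta(A)].  To each 0/1 vector
    [y] attach its class modulo the lattice [B Z^n], of index [|det B| <= D],
    and the entries of [A adj(B) y] on the [m - n] rows outside [B].  By
    Cramer's rule the entries of [A adj(B)] are [n x n] minors of [A], so every
    such entry of [A adj(B) y] is an integer in [[-nD, nD]].  There are at most
    [D (2nD + 1)^(m - n)] keys; if this is below [2^n], two vectors [y <> y']
    share a key, and [v = B^-1 (y - y')] is integral, has [B v] in
    {-1, 0, 1}^n, and is annihilated by the other rows of [A]
    ([exists_flat_direction]).

    With [tau d = 192 d^2] the hypothesis reads [192 D^2 (m - n)^2 <= n], which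
    gives the required inequality when [m > n] ([few_keys]).  When [m = n],
    [P(A, b)] is a full-dimensional simplicial cone and always contains an
    integral point, so that [k = 0] works ([cone_has_integral_point]). *)

(** * Nonemptiness of the relaxation *)

Lemma convex_hull_nonempty (R : realType) (n : nat) (S : set 'cV[R]_n) :
  convex_hull S !=set0 <-> S !=set0.
Proof.
split=> [[x hx]|[x Sx]]; last by exists x; apply: sub_gen_smallest.
apply: contrapT => S0.
apply: (hx set0); split => [y z l|y Sy]; first by rewrite in_setE.
by case: S0; exists y.
Qed.

(** * Minors bounded by [Delta] *)

(** [Delta] only ranges over increasing selections of rows; this sorts an
    arbitrary duplicate-free selection into one of them. *)
Lemma increasing_sel_onto (m n : nat) (g : 'I_n -> 'I_m) : injective g ->
  exists f : {ffun 'I_n -> 'I_m}, increasing_sel f /\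
    forall i, exists j, f j = g i.
Proof.
move=> g_inj; pose A := [set g i | i : 'I_n]%SET.
have cardA : n = #|A| by rewrite card_imset // card_ord.
exists [ffun i => enum_val (cast_ord cardA i)]; split.
  apply/forallP => i; apply/forallP => j; apply/implyP => lt_ij.
  rewrite !ffunE.
  have sA : sorted (fun x y : 'I_m => (x < y)%N) (enum A).
    rewrite /enum_mem; apply: sorted_filter.
      by move=> ? ? ?; apply: ltn_trans.
    rewrite -enumT -(@sorted_map _ _ val ltn) val_enum_ord.
    exact: iota_ltn_sorted.
  rewrite !(enum_val_nth (g i)) /=.
  apply: (sorted_ltn_nth _ _ sA) => //.
  - by move=> ? ? ?; apply: ltn_trans.
  - by rewrite inE -cardE -cardA.
  - by rewrite inE -cardE -cardA.
move=> i; have gA : g i \in A by apply: imset_f.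
exists (cast_ord (esym cardA) (enum_rank_in gA (g i))).
by rewrite ffunE cast_ordKV enum_rankK_in.
Qed.

(** Reordering the rows changes a minor by a sign only, and a repeated row makes
    it vanish, so minors with arbitrary row lists obey the same bound. *)
Lemma normr_det_le_Delta (R : realType) (m n : nat) (C : 'M[R]_(m, n))
    (g : 'I_n -> 'I_m) :
  \rank C = n -> `|\det (rowsub g C)| <= Delta C.
Proof.
move=> rkC; rewrite /Delta rkC.
have [g_inj|g_ninj] := boolP (injectiveb g); last first.
  have /injectivePn[i [j neq_ij eq_g]] := g_ninj.
  rewrite (determinant_alternate neq_ij) ?normr0; last first.
    by move=> k; rewrite !mxE eq_g.
  by elim/big_rec: _ => // fg x _ x_ge0; rewrite le_max x_ge0 orbT.
have [f [f_incr f_onto]] := increasing_sel_onto (injectiveP _ g_inj).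
have [s fs] := fin_all_exists f_onto.
have s_inj : injective s.
  by move=> i j sij; apply: (injectiveP _ g_inj); rewrite -!fs sij.
have -> : rowsub g C = row_perm (perm s_inj) (mxsub f [ffun i => i] C).
  by apply/matrixP => i j; rewrite !mxE permE fs ffunE.
rewrite row_permE det_mulmx det_perm normrM normrX normrN1 expr1n mul1r.
apply: (@le_bigmax_cond _ _ _ _ (f, [ffun i => i])).
rewrite /= f_incr; apply/forallP => i; apply/forallP => j.
by apply/implyP; rewrite !ffunE.
Qed.

Lemma absz_det_le_Delta_int (R : realType) (m n : nat) (A : 'M[int]_(m, n))
    (g : 'I_n -> 'I_m) :
  \rank (intr_mx R A) = n -> (`|\det (rowsub g A)| <= Delta_int R A)%N.
Proof.
move=> rkA; have := normr_det_le_Delta g rkA.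
rewrite -Delta_intE /intr_mx -map_mxsub det_map_mx -intr_norm.
by rewrite pmulrn ler_int; lia.
Qed.

(** Cramer's rule: expanding along row [j], which the cofactors of that row
    do not see. *)
Lemma mul_adj_rowsub (m n : nat) (A : 'M[int]_(m, n)) (f : 'I_n -> 'I_m) i j :
  (A *m \adj (rowsub f A)) i j =
  \det (rowsub (fun k => if k == j then i else f k) A).
Proof.
rewrite (expand_det_row _ j) mxE; apply: eq_bigr => k _.
rewrite !mxE eqxx; congr (_ * (_ * \det _)).
by apply/matrixP => a b; rewrite !mxE eq_sym (negPf (neq_lift _ _)).
Qed.

(** * An integral direction with slopes -1, 0, 1 *)

(** The index of the lattice [B Z^n] in [Z^n] is [|det B|].  With the Smith form
    [B = L E Q], the vector [y] lies in the lattice iff [L^-1 y] lies in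
    [E Z^n], so the residues of [L^-1 y] modulo the diagonal entries of [E]
    separate the classes; their number is the product of these entries. *)
Lemma lattice_classes (n : nat) (B : 'M[int]_n) : \det B != 0 ->
  exists (T : finType) (cls : 'cV[int]_n -> T), #|T| = `|\det B|%N /\
    forall y y', cls y = cls y' -> exists z, y - y' = B *m z.
Proof.
move=> detB; have [L Lu [Q Qu [d _ BE]]] := int_Smith_normal_form B.
have abs_unit (M : 'M[int]_n) : M \in unitmx -> `|\det M|%N = 1%N.
  by rewrite unitmxE => /orP[] /eqP->.
pose e (i : nat) : int := d`_i.
have DE : \matrix_(i < n, j < n) (e i *+ (i == j :> nat)) =
          diag_mx (\row_i e i).
  by apply/matrixP => i j; rewrite !mxE.
rewrite [X in L *m X]DE in BE.
have detE : `|\det B|%N = (\prod_(i < n) `|e i|)%N.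
  rewrite BE !det_mulmx det_diag !abszM !abs_unit // mul1n muln1.
  under [in LHS]eq_bigr do rewrite mxE.
  by elim/big_rec2: _ => // i x y _ <-; rewrite abszM.
have e_gt0 i : (i < n)%N -> (0 < `|e i|)%N.
  move=> lt_in; have: (0 < `|\det B|)%N by rewrite absz_gt0.
  by rewrite detE (bigD1 (Ordinal lt_in)) //= muln_gt0 => /andP[].
(* The index [|e i|.-1.+1] equals [|e i|] and is visibly positive. *)
pose T (i : 'I_n) : finType := 'I_(`|e i|.-1.+1).
exists {dffun forall i, T i}.
pose c (y : 'cV[int]_n) i := `|((invmx L *m y) i 0%R %% e i)%Z|%N.
exists (fun y => [ffun i => inord (c y i) : T i]); split.
  rewrite card_dep_ffun detE foldrE big_map big_enum.
  by apply: eq_bigr => i _; rewrite card_ord prednK // e_gt0.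
move=> y y' /ffunP eq_cls.
have c_lt u i : (c u i < `|e i|.-1.+1)%N.
  rewrite /c prednK ?e_gt0 //.
  have ei : e i != 0 by rewrite -absz_gt0 e_gt0.
  have := ltz_mod ((invmx L *m u) i 0%R) ei.
  have := modz_ge0 ((invmx L *m u) i 0%R) ei.
  lia.
have div_e i : (e i %| (invmx L *m (y - y')) i 0%R)%Z.
  have := congr1 val (eq_cls i); rewrite !ffunE /= !inordK // /c.
  have ei : e i != 0 by rewrite -absz_gt0 e_gt0.
  have := modz_ge0 ((invmx L *m y) i 0%R) ei.
  have := modz_ge0 ((invmx L *m y') i 0%R) ei.
  move=> h1 h2 h3; rewrite mulmxBr.
  rewrite [X in (_ %| X)%Z]mxE [X in (_ %| _ + X)%Z]mxE.
  by rewrite -eqz_mod_dvd; apply/eqP; lia.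
exists (invmx Q *m \col_i ((invmx L *m (y - y')) i 0%R %/ e i)%Z).
rewrite BE mulmxA mulmxK // -mulmxA -[LHS](mulKVmx Lu); congr (L *m _).
apply/matrixP => i j; rewrite ord1 mul_diag_mx !mxE mulrC divzK //.
by have := div_e i; rewrite mxE.
Qed.

(** Pigeonhole over the [2^n] vectors [y] in {0, 1}^n.  The hypothesis counts
    keys: at most [D] classes modulo the lattice spanned by the selected rows,
    and [2nD + 1] values on each of the [m - n] remaining rows. *)
Lemma exists_flat_direction (m n D : nat) (A : 'M[int]_(m, n))
    (f : 'I_n -> 'I_m) :
  \det (rowsub f A) != 0 ->
  (forall g : 'I_n -> 'I_m, (`|\det (rowsub g A)| <= D)%N) ->
  (D * (2 * n * D).+1 ^ (m - n) < 2 ^ n)%N ->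
  exists v : 'cV[int]_n, v != 0 /\ forall i, `|(A *m v) i 0%R| <= 1.
Proof.
move=> detB le_D few; set B := rowsub f A in detB.
have f_inj : injective f.
  move=> i j eq_f; apply/eqP/negPn/negP => neq_ij; case/negP: detB; apply/eqP.
  by apply: (determinant_alternate neq_ij) => k; rewrite !mxE eq_f.
have [T [cls [cardT clsE]]] := lattice_classes detB.
pose y (S : {set 'I_n}) : 'cV[int]_n := \col_i (i \in S)%:R.
pose M := A *m \adj B; pose J := {i : 'I_m | i \notin codom f}.
have M_le i j : `|M i j| <= D%:Z.
  by rewrite /M /B mul_adj_rowsub -abszE lez_nat le_D.
have My_le S i : `|(M *m y S) i 0%R| <= (n * D)%:Z.
  rewrite mxE; apply: le_trans (ler_norm_sum _ _ _) _.
  apply: le_trans (_ : \sum_(j < n) D%:Z <= _); last first.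
    by rewrite sumr_const card_ord -mulr_natl natz -PoszM.
  apply: ler_sum => j _; rewrite normrM [y S j 0]mxE; have := M_le i j.
  by case: (j \in S) => /=; rewrite ?normr1 ?mulr1 ?normr0 ?mulr0.
(* The shift by [n D] turns an integer of [[-nD, nD]] into an index in
   [[0, 2nD]]. *)
pose N := (2 * n * D)%N.
pose c S i := `|((M *m y S) i 0 + (n * D)%:Z)%R|%N.
have c_lt S i : (c S i < N.+1)%N.
  by rewrite /c /N; have := My_le S i; lia.
pose key S := (cls (y S), [ffun i : J => inord (c S (val i)) : 'I_N.+1]).
have /injectivePn[S [S' neq_S eq_key]] : ~~ injectiveb key.
  apply/negP => /injectiveP /leq_card; apply/negP; rewrite -ltnNge.
  rewrite card_prod card_ffun card_ord cardT card_sig.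
  rewrite -cardsT -powersetT card_powerset cardsT card_ord.
  apply: leq_ltn_trans few; apply: leq_mul; first exact: le_D.
  rewrite leq_pexp2l //.
  have <- : #|[predC codom f]| = (m - n)%N.
    have := cardC (mem (codom f)); rewrite (card_codom f_inj) !card_ord => eq_m.
    exact: etrans (esym (addKn n _)) (congr1 (subn^~ n) eq_m).
  exact/eq_leq/eq_card.
have [v Bv] := clsE _ _ (congr1 fst eq_key).
have Bv_le j : `|(B *m v) j 0| <= 1.
  by rewrite -Bv !mxE; case: (j \in S); case: (j \in S').
exists v; split.
  apply: contra neq_S => /eqP v0; apply/eqP/setP => j.
  move/matrixP: Bv => /(_ j 0); rewrite v0 mulmx0 !mxE.
  by case: (j \in S); case: (j \in S').
move=> i; have [/codomP[j ->]|iNf] := boolP (i \in codom f).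
  by have := Bv_le j; rewrite mul_rowsub_mx mxE.
(* On such a row, [det B * A v = A adj(B) (B v)] and [B v = y S - y S'], two
   vectors with the same value under [A adj(B)]. *)
suff -> : (A *m v) i 0 = 0 by [].
have Mi : (M *m y S) i 0 = (M *m y S') i 0.
  move/ffunP: (congr1 snd eq_key) => /(_ (exist _ i iNf)).
  move/(congr1 val); rewrite /= !ffunE /= !inordK // /c.
  have := My_le S i; have := My_le S' i.
  by move: ((M *m y S) i 0) ((M *m y S') i 0) => a a'; lia.
have : \det B * (A *m v) i 0 = 0.
  have <- : (M *m (B *m v)) i 0 = \det B * (A *m v) i 0.
    rewrite /M -mulmxA [\adj B *m _]mulmxA mul_adj_mx mul_scalar_mx.
    by rewrite -scalemxAr mxE.
  by rewrite -Bv mulmxBr !mxE in Mi *; rewrite Mi subrr.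
by move/eqP; rewrite mulf_eq0 (negPf detB) => /eqP.
Qed.

(** * Rounding along an integral direction *)

(** By the Smith form, [v] is a multiple of the first column of a unimodular
    matrix [L].  The last [n - 1] rows of [L^-1] then read off all coordinates
    of [x] in the basis [L] except the one along [v]. *)
Lemma exists_line_relaxation (n : nat) (v : 'cV[int]_n) : v != 0 ->
  exists W : 'M[int]_(n.-1, n), forall (R : realType) (x : 'cV[R]_n),
    integral_vectors R n.-1 (intr_mx R W *m x) ->
    exists (w : 'cV[int]_n) (s : R), x = intr_mx R w + s *: intr_mx R v.
Proof.
case: n v => [|n] v v0; first by rewrite (flatmx0 v) eqxx in v0.
have [L Lu [Q Qu [d _ vE]]] := int_Smith_normal_form v.
have {vE} [a vE] : exists a, v = a *: col 0 L.
  exists (d`_0 * Q 0 0); rewrite {1}vE; apply/matrixP => i j.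
  rewrite ord1 !mxE big_ord1 !mxE.
  rewrite (bigD1 0) //= big1 => [|k k0]; last first.
    by rewrite !mxE -[_ == _ :> nat]/(k == 0) (negPf k0) mulr0n mulr0.
  by rewrite !mxE eqxx mulr1n addr0; ring.
have a0 : a != 0 by apply: contra v0 => /eqP a0; rewrite vE a0 scale0r.
exists (rowsub (lift 0) (invmx L)) => R x Wx.
have LK : intr_mx R L *m (intr_mx R (invmx L) *m x) = x.
  by rewrite mulmxA /intr_mx -map_mxM mulmxV // map_mx1 mul1mx.
set u := intr_mx R (invmx L) *m x in LK.
pose z : 'cV[int]_n.+1 := \col_i (if i == 0 then 0 else Num.floor (u i 0)).
have uE : u = intr_mx R z + u 0 0 *: delta_mx 0 0.
  apply/matrixP => i j; rewrite ord1 [RHS]mxE [X in X + _]mxE [z _ _]mxE.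
  rewrite [X in _ + X]mxE [delta_mx _ _ _ _]mxE.
  case: (unliftP 0 i) => [k|] ->; last by rewrite mulr1 add0r.
  have := Wx k; rewrite /intr_mx map_mxsub mul_rowsub_mx [X in X \in _]mxE.
  by move/floorK => ->; rewrite mulr0 addr0.
exists (L *m z), (u 0 0 / a%:~R).
rewrite -[LHS]LK uE mulmxDr /intr_mx map_mxM; congr (_ + _).
rewrite -scalemxAr -colE vE; move: (u 0 0) => s.
by apply/matrixP => i j; rewrite !mxE rmorphM /=; field; rewrite intr_eq0.
Qed.

(** A slope 1 bounds [s] above by the integer [b_i - (A w)_i], a slope -1
    bounds it below by [(A w)_i - b_i]; [ceil s] respects both. *)
Lemma flat_direction_rounding (R : realType) (m n : nat) (A : 'M[int]_(m, n))
    (b : 'cV[int]_m) (v w : 'cV[int]_n) (s : R) :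
  (forall i, `|(A *m v) i 0| <= 1) ->
  polyhedron R A b (intr_mx R w + s *: intr_mx R v) ->
  polyhedron R A b (intr_mx R (w + Num.ceil s *: v)).
Proof.
move=> Av Px i; have := Px i; have := Av i.
rewrite mulmxDr -scalemxAr /intr_mx -!map_mxM mulmxDr -scalemxAr.
rewrite 3![in X in _ -> X -> _]mxE !mxE.
set q := \sum_j _; set p := \sum_j _ => /= q_le.
have [->|[->|->]] : q = 0 \/ q = 1 \/ q = -1 by lia.
- by rewrite !mulr0 !addr0.
- rewrite !mulr1 ler_int => h.
  have : Num.ceil s <= b i 0 - p by rewrite ceil_le_int intrB; lra.
  lia.
- rewrite !mulrN1 ler_int => h.
  have : p - b i 0 <= Num.ceil s.
    by rewrite -(ler_int R); apply: le_trans (ceil_ge _); rewrite intrB; lra.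
  lia.
Qed.

(** * The square case *)

(** The witness is [- (det A) adj(A) |b|], which [A] maps to
    [- (det A)^2 |b| <= b]. *)
Lemma cone_has_integral_point (R : realType) (n : nat) (A : 'M[int]_n)
    (b : 'cV[int]_n) : \det A != 0 ->
  exists w : 'cV[int]_n, polyhedron R A b (intr_mx R w).
Proof.
move=> detA; exists (\adj A *m (- \det A *: \col_i `|b i 0|)) => i.
rewrite /intr_mx -map_mxM [X in X <= _]mxE [X in _ <= X]mxE ler_int.
rewrite mulmxA mul_mx_adj mul_scalar_mx !mxE.
move: (b i 0) (\det A) detA => x a a0.
have : 1 <= a * a by nia.
nia.
Qed.

(** * Choice of the threshold *)

(** With [p = q / 4], the exponential side is at least [(p + 1)^4], while
    [q (q + 1) < 16 (p + 1)^2] and [16 c <= p]. *)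
Lemma mul_exp_lt_exp2 (c q : nat) :
  (64 * c <= q)%N -> (c * q * q.+1 < 2 ^ q)%N.
Proof.
move=> le_q; pose p := (q %/ 4)%N.
have qE : (4 * p <= q < 4 * p + 4)%N by rewrite /p; lia.
have h1 : ((p.+1) ^ 4 <= 2 ^ q)%N.
  apply: leq_trans (_ : 2 ^ (p * 4) <= _)%N; last by rewrite leq_pexp2l //; lia.
  by rewrite expnM leq_exp2r // ltn_expl.
apply: leq_trans h1; rewrite !expnS expn0.
have h2 : (q * q.+1 < 16 * (p.+1 * p.+1))%N by nia.
have h3 : (16 * c <= p)%N by lia.
nia.
Qed.

(** Both sides are compared through [t]-th powers.  For [q = n / t] (rounded
    down), [2^n >= (2^q)^t], and the left side is at most [(3 d^2 n)^t].  Since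
    [t <= q], [n < t (q + 1) <= q (q + 1)], so that the exponential bound
    applies with [c = 3 d^2], whence the constant [192 = 64 * 3]. *)
Lemma few_keys (d n t : nat) : (0 < d)%N -> (0 < t)%N ->
  (192 * d ^ 2 * t ^ 2 <= n)%N -> (d * (2 * n * d).+1 ^ t < 2 ^ n)%N.
Proof.
move=> d0 t0 le_n; pose q := (n %/ t)%N.
have qle : (q * t <= n)%N by rewrite leq_trunc_div.
have qlt : (n < q.+1 * t)%N by rewrite ltn_ceil.
have le_q : (64 * (3 * d ^ 2) <= q)%N.
  by rewrite leq_divRL //; apply: leq_trans le_n; nia.
have tq : (t <= q)%N by rewrite leq_divRL //; apply: leq_trans le_n; nia.
have n0 : (0 < n)%N by nia.
have lt2 := mul_exp_lt_exp2 le_q.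
apply: leq_ltn_trans (_ : (3 * d ^ 2 * n) ^ t < _)%N.
  apply: leq_trans (_ : d ^ t * (2 * n * d).+1 ^ t <= _)%N.
    by rewrite leq_mul2r -[X in (X <= d ^ t)%N]expn1 leq_pexp2l ?orbT.
  by rewrite -expnMn leq_exp2r //; nia.
apply: leq_trans (_ : (2 ^ q) ^ t <= _)%N; last by rewrite -expnM leq_pexp2l.
rewrite ltn_exp2r //; apply: leq_ltn_trans lt2.
by rewrite -[X in (_ <= X)%N]mulnA leq_mul2l; apply/orP; right; nia.
Qed.

(** * Fewer than n integrality constraints *)

Theorem corollary1 (R : realType) :
  exists tau : nat -> R,
    (forall d : nat, (0 < d)%N -> 1 <= tau d) /\
    forall (m n : nat) (A : 'M[int]_(m, n)),
      (0 < m)%N -> (0 < n)%N ->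
      \rank (intr_mx R A) = n ->
      m%:R <= n%:R + Num.sqrt (n%:R / tau (Delta_int R A)) ->
      forall b : 'cV[int]_m,
        exists (k : nat) (W : 'M[int]_(k, n)),
          (k < n)%N /\
          (W_MIP R W A b !=set0 <->
           polyhedron R A b `&` integral_vectors R n !=set0).
Proof.
exists (fun d => (192 * d ^ 2)%:R); split=> [d d0|m n A m0 n0 rkA le_m b].
  by rewrite ler1n; nia.
have intP w : integral_vectors R n (intr_mx R w).
  by move=> i; rewrite mxE intr_int.
have full : row_full (intr_mx R A) by rewrite /row_full rkA.
pose f := fullrankfun full.
have detf : \det (rowsub f A) != 0.
  have := fullrowsub_unit full; rewrite unitmxE unitfE -/f.
  by rewrite /intr_mx -map_mxsub det_map_mx intr_eq0.
have le_D g := absz_det_le_Delta_int g rkA.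
set D := Delta_int R A in le_m le_D.
have le_nm : (n <= m)%N.
  by have := leq_card f (@fullrankfun_inj _ _ _ _ full); rewrite !card_ord.
have [eq_mn|lt_nm] : m = n \/ (n < m)%N by lia.
  subst m; have detA : \det A != 0.
    by have := full; rewrite row_full_unit unitmxE unitfE det_map_mx intr_eq0.
  have [w Pw] := cone_has_integral_point R b detA.
  exists 0%N, 0; split=> //; split=> _; first by exists (intr_mx R w).
  apply/convex_hull_nonempty; exists (intr_mx R w); split=> // i.
  by case: i.
have D0 : (0 < D)%N.
  by apply: leq_trans (le_D f); rewrite absz_gt0.
have few : (D * (2 * n * D).+1 ^ (m - n) < 2 ^ n)%N.
  apply: few_keys; rewrite ?subn_gt0 //.
  have t0 : (0 : R) < (192 * D ^ 2)%:R by rewrite ltr0n; nia.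
  have : (m - n)%:R <= Num.sqrt (n%:R / (192 * D ^ 2)%:R) :> R.
    by rewrite natrB // lerBlDl.
  rewrite -(ler_pXn2r (isT : (0 < 2)%N)) ?nnegrE ?sqrtr_ge0 //.
  rewrite sqr_sqrtr ?divr_ge0 // ler_pdivlMr // mulrC -natrX -natrM ler_nat.
  by [].
have [v [v0 Av]] := exists_flat_direction detf le_D few.
have [W WE] := exists_line_relaxation v0.
exists n.-1, W; split; first by rewrite prednK.
rewrite /W_MIP; split=> [/convex_hull_nonempty[x [Px Wx]]|[x [Px ix]]].
  have [w [s xE]] := WE R x Wx; rewrite xE in Px.
  have Pw := flat_direction_rounding Av Px.
  by exists (intr_mx R (w + Num.ceil s *: v)).
apply/convex_hull_nonempty; exists x; split=> // i.
by rewrite mxE rpred_sum // => j _; rewrite mxE rpredM ?intr_int.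
Qed.
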